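(* If $G$ is a $2$-connected plane graph with exactly three faces and maximum face degree $\Delta^*(G)$, then $\chi_c(G) \leq \lfloor \frac{3}{2}\Delta^*(G)\rfloor$.
   Context: Plane graphs may have multiple edges but no loops. The degree of a face is the number of vertices incident with it; $\Delta^*(G)$ is the maximum face degree. A cyclic coloring of a plane graph is a vertex coloring in which any two distinct vertices incident with a common face receive distinct colors; $\chi_c(G)$, the cyclic chromatic number, is the minimum number of colors in a cyclic coloring of $G$. *)

(* Defs.v *)
From HB Require Import structures.
From mathcomp Require Import all_boot all_fingroup.

Set Implicit Arguments.
Unset Strict Implicit.
Unset Printing Implicit Defensive.

(* A loopless finite multigraph embedded in an oriented closed surface, given
   by its rotation system.  Each edge is a pair {d, rev d} of opposite darts,
   the dart d going from src d to src (rev d), and parallel edges are distinct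
   pairs.  The permutation rot sends a dart to the next one, in counterclockwise
   order, among the darts leaving the same vertex.  By rev_src the involution
   rev has no fixed point. *)
Record embedded_graph := EmbeddedGraph {
  vertex : finType;
  dart : finType;
  src : dart -> vertex;
  rev : {perm dart};
  rot : {perm dart};
  revK : involutive rev;
  rev_src : forall d, src (rev d) != src d;
  rot_src : forall d e, (e \in porbit rot d) = (src e == src d)
}.

Section EmbeddedGraphTheory.
Variable G : embedded_graph.

(* Traversing a face boundary: follow d, then leave its head along the next
   dart of the rotation, d |-> rot (rev d). *)
Definition face_perm : {perm dart G} := (rev G * rot G)%g.

(* A face is identified with the set of darts of its boundary walk. *)
Definition faces : {set {set dart G}} := porbits face_perm.

Definition incident (v : vertex G) (f : {set dart G}) : bool :=
  [exists d in f, src d == v].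

Definition face_degree (f : {set dart G}) : nat :=
  #|[set v | incident v f]|.

Definition max_face_degree : nat := \max_(f in faces) face_degree f.

Definition adjacent : rel (vertex G) :=
  [rel u v | [exists d, (src d == u) && (src (rev G d) == v)]].

Definition connected : Prop :=
  0 < #|vertex G| /\ forall u v, connect adjacent u v.

(* The induced subgraph on the vertices other than w. *)
Definition adjacent_minus (w : vertex G) : rel (vertex G) :=
  [rel u v | [&& u != w, v != w & adjacent u v]].

(* Two vertices joined by at least two parallel edges count as 2-connected. *)
Definition two_connected : Prop :=
  [/\ 1 < #|vertex G|, connected &
      forall w u v, u != w -> v != w -> connect (adjacent_minus w) u v].

(* A rotation system of a connected graph with at least one edge determines a
   cellular embedding, whose surface is the sphere exactly when its Euler
   characteristic V - E + F is 2; the number of edges is #|dart G|./2. *)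
Definition plane : Prop :=
  connected /\ #|vertex G| + #|faces| = #|dart G|./2 + 2.

Definition cyclic_coloring (k : nat) (c : {ffun vertex G -> 'I_k}) : bool :=
  [forall f in faces, forall u, forall v,
    [&& u != v, incident u f & incident v f] ==> (c u != c v)].

Definition cyclic_colorable (k : nat) : bool :=
  [exists c : {ffun vertex G -> 'I_k}, cyclic_coloring c].

Lemma cyclic_colorable_ex : exists k, cyclic_colorable k.
Proof.
exists #|vertex G|; apply/existsP; exists [ffun v => enum_rank v].
apply/forall_inP => f _; apply/forallP => u; apply/forallP => v.
apply/implyP => /and3P[neq_uv _ _].
by rewrite !ffunE (inj_eq enum_rank_inj).
Qed.

Definition cyclic_chromatic_number : nat := ex_minn cyclic_colorable_ex.

End EmbeddedGraphTheory.

(* Main.v *)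
Require Import Defs.
From mathcomp Require Import all_boot all_fingroup.
From mathcomp Require Import all_algebra.

(** Every vertex lies on at least two faces, so double counting the incidences
    gives [2 * #|V| <= 3 * max_face_degree], and colouring all the vertices
    differently is good enough.  To find two faces at a vertex [v], take an edge
    at [v]: both its sides are faces incident with [v], and it is not a bridge,
    so it suffices that in a plane graph only a bridge has the same face on both
    sides.  This is a rank count in the edge space: the coboundaries of vertices
    are orthogonal to the boundaries of faces, their ranks are [V - 1] and
    [F - 1], and these add up to [E] by Euler's formula; the indicator of a
    non-bridge with a single face on both sides would be an additional vector,
    independent of the coboundaries and orthogonal to the boundaries. *)

Set Implicit Arguments.
Unset Strict Implicit.
Unset Printing Implicit Defensive.

Import GRing.Theory.

(** * Constancy along paths, orbits, and ranks from kernels *)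

Lemma connect_const (T : finType) (S : Type) (e : rel T) (phi : T -> S) :
  (forall u v, e u v -> phi u = phi v) ->
  forall u v, connect e u v -> phi u = phi v.
Proof.
move=> e_phi u v /connectP[p + ->] {v}.
elim: p u => [|x p IHp] u //= /andP[/e_phi-> ux]; exact: IHp.
Qed.

Lemma mem_porbit1 (T : finType) (s : {perm T}) x : s x \in porbit s x.
Proof. by have := mem_porbit s 1 x; rewrite expg1. Qed.

(** Rank-nullity: a left kernel inside a line has dimension at most one. *)
Lemma leq_rank_kernel_line (F : fieldType) m n (M : 'M[F]_(m, n)) (u : 'rV_m) :
  (forall x : 'rV_m, x *m M = 0 -> (x <= u)%MS)%R -> m <= (\rank M).+1.
Proof.
move=> ker_u; have: (kermx M <= u)%MS.
  by apply/row_subP => i; apply: ker_u; apply/sub_kermxP; rewrite row_sub.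
move/mxrankS/leq_trans/(_ (rank_leq_row _)).
by rewrite mxrank_ker leq_subLR addn1.
Qed.

Section EdgeSpace.
Variable G : embedded_graph.
Implicit Types (d e : dart G) (f : {set dart G}) (u v w : vertex G).
Local Notation face d := (porbit (face_perm G) d).
Local Notation F := rat.
Local Notation rev := Defs.rev.
Local Notation rot := Defs.rot.
Local Notation revK := (@Defs.revK G).

(** * Darts, edges and faces *)

Lemma rev_neq d : rev G d != d.
Proof. by apply: contraNneq (rev_src d) => ->. Qed.

Lemma src_rot d : src (rot G d) = src d.
Proof. by apply/eqP; rewrite -rot_src mem_porbit1. Qed.

Lemma face_eq f d : f \in faces G -> d \in f -> f = face d.
Proof.
by case/imsetP=> e _ ->; rewrite -eq_porbit_mem => /eqP->.
Qed.

Lemma face_in_faces d : face d \in faces G.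
Proof. exact: imset_f. Qed.

Lemma face_rev d : face (rev G d) = face (rot G d).
Proof.
have ->: rot G d = face_perm G (rev G d) by rewrite permM revK.
by apply/eqP; rewrite eq_sym eq_porbit_mem mem_porbit1.
Qed.

Lemma mem_face_rev f d :
  f \in faces G -> (rev G d \in f) = (rot G d \in f).
Proof. by case/imsetP=> e _ ->; rewrite -!eq_porbit_mem face_rev. Qed.

(* One dart of each edge. *)
Definition orientation : {set dart G} :=
  [set d | enum_rank d < enum_rank (rev G d)].

Lemma orientation_rev d : (rev G d \in orientation) = (d \notin orientation).
Proof.
rewrite !inE revK -leqNgt ltn_neqAle; case: eqP => // /ord_inj/enum_rank_inj.
by move/eqP; rewrite (negPf (rev_neq d)).
Qed.

Lemma big_orientation (g : dart G -> F) :
  (\sum_d g d = \sum_(d in orientation) (g d + g (rev G d)))%R.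
Proof.
rewrite (bigID (mem orientation)) big_split /=; congr (_ + _)%R.
rewrite (reindex_inj (@perm_inj _ (rev G))) /=.
by apply: eq_bigl => d; rewrite orientation_rev negbK.
Qed.

Lemma card_orientation : #|orientation| = #|dart G|./2.
Proof.
have <-: #|orientation| + #|~: orientation| = #|dart G| by rewrite cardsC.
have ->: #|~: orientation| = #|orientation|.
  rewrite -(card_imset _ (@perm_inj _ (rev G))); congr #|pred_of_set _|.
  apply/setP=> d; rewrite -{1}(revK d) mem_imset; last exact: perm_inj.
  by rewrite inE orientation_rev negbK.
by rewrite addnn doubleK.
Qed.

(** * Vertex coboundaries and face boundaries *)

Definition coboundary : 'M[F]_(#|vertex G|, #|orientation|) :=
  (\matrix_(i, j) ((src (enum_val j) == enum_val i)%:R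
                 - (src (rev G (enum_val j)) == enum_val i)%:R))%R.

(** The signed incidence matrix of the dual graph; an edge with the same face on both sides gives a
    zero column. *)
Definition boundary : 'M[F]_(#|faces G|, #|orientation|) :=
  (\matrix_(i < #|faces G|, j < #|orientation|)
    ((enum_val j \in enum_val i)%:R - (rev G (enum_val j) \in enum_val i)%:R))%R.

Lemma mul_coboundary (x : 'rV_#|vertex G|) j :
  ((x *m coboundary) 0 j = x 0 (enum_rank (src (enum_val j)))
                         - x 0 (enum_rank (src (rev G (enum_val j)))))%R.
Proof.
have delta v : (\sum_i x 0 i * (v == enum_val i)%:R = x 0 (enum_rank v))%R.
  rewrite (bigD1 (enum_rank v)) //= enum_rankK eqxx mulr1 big1 ?addr0 // => i.
  by case: (v =P _) => [->|_ _]; rewrite ?enum_valK ?eqxx // mulr0.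
rewrite mxE -!delta -sumrB; apply: eq_bigr => i _.
by rewrite mxE mulrBr.
Qed.

Definition face_index d : 'I_#|faces G| := enum_rank_in (face_in_faces d) (face d).

Lemma mul_boundary (x : 'rV_#|faces G|) j :
  ((x *m boundary) 0 j = x 0 (face_index (enum_val j))
                       - x 0 (face_index (rev G (enum_val j))))%R.
Proof.
have delta d : (\sum_i x 0 i * (d \in enum_val i)%:R = x 0 (face_index d))%R.
  rewrite (bigD1 (face_index d)) //= enum_rankK_in ?face_in_faces //.
  rewrite porbit_id mulr1 big1 ?addr0 // => i; case: (boolP (d \in _)) => [di|].
    rewrite -(inj_eq enum_val_inj) enum_rankK_in ?face_in_faces //.
    by rewrite -(face_eq (enum_valP i) di) eqxx.
  by rewrite mulr0.
rewrite mxE -!delta -sumrB; apply: eq_bigr => i _.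
by rewrite mxE mulrBr.
Qed.

(** A boundary walk enters a vertex as often as it leaves it. *)
Lemma coboundary_boundary_orthogonal : (coboundary *m boundary^T = 0)%R.
Proof.
apply/matrixP => i k; rewrite !mxE.
set v := enum_val i; set f := enum_val k.
have fF : f \in faces G by apply: enum_valP.
(* Splitting each edge into its two darts leaves a sum over the darts at [v], where [rot] matches
   departures with arrivals. *)
pose g d : F := ((src d == v)%:R * ((d \in f)%:R - (rev G d \in f)%:R))%R.
transitivity (\sum_d g d)%R.
  rewrite big_orientation [RHS]big_enum_val; apply: eq_bigr => j _.
  rewrite !mxE /g revK -/v -/f.
  by rewrite mulrBl -mulrN opprB.
under eq_bigr => d _ do rewrite /g mulrBr.
rewrite sumrB [X in (X - _)%R](reindex_inj (@perm_inj _ (rot G))) /=.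
apply/eqP; rewrite subr_eq0; apply/eqP/eq_bigr => d _.
by rewrite src_rot mem_face_rev.
Qed.

(** * Connectivity of the dual graph and the rank of [boundary] *)

Lemma connected_dart v : 1 < #|vertex G| -> connected G ->
  exists d, src d = v.
Proof.
move=> V_gt1 [_ conn]; have: 0 < #|predC1 v|.
  by rewrite cardC1; case: #|vertex G| V_gt1 => [|[]].
case/card_gt0P=> w wv; case/connectP: (conn v w) => -[|x p] /=.
  by move=> _ wE; rewrite wE inE eqxx in wv.
by case/andP=> /existsP[d /andP[/eqP <- _]] _ _; exists d.
Qed.

(** Invariance under [face_perm] and [rev] gives invariance under [rot], so [psi] is constant around
    each vertex and along each path. *)
Lemma face_function_const (S : Type) (psi : dart G -> S) :
  connected G ->
  (forall d, psi (face_perm G d) = psi d) -> (forall d, psi (rev G d) = psi d) ->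
  forall d e, psi d = psi e.
Proof.
move=> [_ conn] psi_face psi_rev d e.
have psi_rot x : psi (rot G x) = psi x.
  by rewrite -(psi_rev x) -[RHS]psi_face permM revK.
have psi_src x y : src x = src y -> psi x = psi y.
  move=> /eqP; rewrite -rot_src => /porbitP[n ->] {x}.
  by elim: n => [|n IHn]; rewrite ?expg0 ?perm1 // expgSr permM psi_rot.
case/connectP: (conn (src d) (src e)) => p; elim: p d => [|v p IHp] d /=.
  by move=> _ /esym/psi_src.
case/andP=> /existsP[x /andP[/eqP xd /eqP xv]] vp e_last.
by rewrite -(psi_src x) // -psi_rev; apply: IHp; rewrite xv.
Qed.

(** A left kernel vector takes equal values on the two sides of every edge, hence is constant. *)
Lemma rank_boundary : connected G -> #|faces G| <= (\rank boundary).+1.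
Proof.
move=> conn; apply: (@leq_rank_kernel_line _ _ _ _ (const_mx 1%R)) => x xB0.
pose psi d := x ord0 (face_index d).
have psi_face d e : face d = face e -> psi d = psi e.
  by move=> de; congr (x ord0 _); apply: enum_val_inj;
     rewrite !enum_rankK_in ?face_in_faces.
have psi_const d e : psi d = psi e.
  apply: face_function_const => // {d e} d.
    by apply: psi_face; apply/eqP; rewrite eq_porbit_mem mem_porbit1.
  wlog dO : d / d \in orientation => [wlog_dO|].
    have [/wlog_dO //|] := boolP (d \in orientation).
    by rewrite -orientation_rev => /wlog_dO; rewrite revK.
  have := mul_boundary x (enum_rank_in dO d).
  by rewrite xB0 mxE enum_rankK_in // => /esym/subr0_eq/esym.
have psiE i : exists d, x ord0 i = psi d.
  have /imsetP[d _ id] := enum_valP i; exists d; congr (x ord0 _).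
  by apply: enum_val_inj; rewrite enum_rankK_in ?face_in_faces.
have [a xa]: exists a, x = const_mx a.
  case: (pickP 'I_#|faces G|) => [i _|no_i].
    exists (x ord0 i); apply/rowP=> j; rewrite mxE.
    by have [d ->] := psiE i; have [e ->] := psiE j.
  by exists 0%R; apply/rowP => i; have := no_i i.
have ->: x = (a *: const_mx 1)%R by apply/rowP => i; rewrite xa !mxE mulr1.
exact: scalemx_sub.
Qed.

(** * Edges that are not bridges have two different sides *)

Definition adjacent_without d : rel (vertex G) :=
  [rel u v | [exists e,
    [&& e \notin [set d; rev G d], src e == u & src (rev G e) == v]]].

Definition edge_indicator d : 'rV[F]_#|orientation| :=
  (\row_j (enum_val j \in [set d; rev G d])%:R)%R.

(** In a linear relation among the rows, the vertex coefficients agree across every edge but that of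
    [d], hence everywhere; the coordinate of that edge then forces the indicator's coefficient to
    vanish. *)
Lemma rank_coboundary_indicator d :
  (forall u v, connect (adjacent_without d) u v) ->
  #|vertex G| <= \rank (col_mx coboundary (edge_indicator d)).
Proof.
move=> conn; rewrite -ltnS -[X in X < _]addn0 -addnS.
apply: (@leq_rank_kernel_line _ _ _ _ (row_mx (const_mx 1%R) 0%R)) => z.
rewrite -[z]hsubmxK; move: (lsubmx z) (rsubmx z) => x y {z}.
rewrite mul_row_col => /rowP xy0.
pose phi v := x ord0 (enum_rank v).
have eq0 e : e \in orientation ->
    (phi (src e) - phi (src (rev G e))
     + y 0 0 * (e \in [set d; rev G d])%:R = 0)%R.
  move=> eO; have := xy0 (enum_rank_in eO e); rewrite mxE mul_coboundary.
  by rewrite [(y *m _)%R _ _]mxE big_ord1 !mxE enum_rankK_in.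
have phi_edge e : e \in orientation -> e \notin [set d; rev G d] ->
    phi (src e) = phi (src (rev G e)).
  move=> /eq0 + /negPf ed; rewrite ed mulr0 addr0; exact: subr0_eq.
have rev_set e : (rev G e \in [set d; rev G d]) = (e \in [set d; rev G d]).
  rewrite !inE orbC (inj_eq perm_inj); congr (_ || _).
  by rewrite -{1}(revK d) (inj_eq perm_inj).
have phi_const u v : phi u = phi v.
  apply: connect_const (conn u v) => {u v} u v.
  case/existsP=> e /and3P[ed /eqP <- /eqP <-].
  have [/phi_edge-> //|] := boolP (e \in orientation).
  by rewrite -orientation_rev => /phi_edge; rewrite rev_set revK => /(_ ed).
have y0 : y = 0%R.
  have [e eO ed] : exists2 e, e \in orientation & e \in [set d; rev G d].
    have [dO|] := boolP (d \in orientation); first by exists d; rewrite ?set21.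
    by rewrite -orientation_rev; exists (rev G d); rewrite ?set22.
  have := eq0 e eO; rewrite (phi_const _ (src (rev G e))) subrr add0r ed mulr1.
  by move=> y00; apply/rowP=> i; rewrite ord1 y00 mxE.
have ->: row_mx x y = (phi (src d) *: row_mx (const_mx 1) 0)%R.
  rewrite scale_row_mx y0 scaler0; congr row_mx; apply/rowP=> i.
  by rewrite !mxE mulr1 (phi_const _ (enum_val i)) /phi enum_valK.
exact: scalemx_sub.
Qed.

Lemma plane_nonbridge_faces d : plane G ->
  (forall u v, connect (adjacent_without d) u v) -> face (rev G d) != face d.
Proof.
move=> [conn euler] conn_d; apply/eqP => same_face.
have orth: (col_mx coboundary (edge_indicator d) *m boundary^T = 0)%R.
  rewrite mul_col_mx coboundary_boundary_orthogonal -[RHS]vsubmxK linear0 linear0.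
  congr col_mx; apply/rowP=> k; rewrite !mxE big1 // => j _; rewrite !mxE.
  have := enum_valP k; move: (enum_val k) (enum_val j) => f e fF.
  have fd : (rev G d \in f) = (d \in f).
    by case/imsetP: fF => c _ ->; rewrite -!eq_porbit_mem same_face.
  (* Only the edge of [d] contributes, and there the boundary entry cancels. *)
  by rewrite !inE; do 2?[case: eqP => [->|_]]; rewrite ?mul0r // ?revK fd subrr mulr0.
(* By Euler's formula the two ranks add up to at least E + 1, while orthogonality in dimension E
   allows at most E. *)
have := leq_add (rank_coboundary_indicator conn_d) (rank_boundary conn).
rewrite euler addn2 addnS ltnS -(mxrank_tr boundary) => /leq_trans/(_ (mulmx0_rank_max orth)).
by rewrite card_orientation ltnn.
Qed.

(** Deleting an end of [d] also deletes its edge, so paths avoiding that end avoid the edge. A third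
    vertex [x] links the paths avoiding one end to those avoiding the other; it rules out a lone
    edge on two vertices. *)
Lemma two_connected_nonbridge d : two_connected G -> 2 < #|vertex G| ->
  forall u v, connect (adjacent_without d) u v.
Proof.
move=> [_ _ conn] V_gt2.
have connS w : w \in [set src d; src (rev G d)] ->
    forall u v, u != w -> v != w -> connect (adjacent_without d) u v.
  move=> wd u v uw vw; apply: connect_sub (conn w u v uw vw) => {u v uw vw} u v.
  case/and3P=> uw vw /existsP[e /andP[/eqP eu /eqP ev]]; apply: connect1.
  apply/existsP; exists e; rewrite eu ev !eqxx !andbT.
  apply: contraTN wd; rewrite !inE => /orP[] /eqP ed;
    by move: eu ev; rewrite ed ?revK => -> ->; rewrite !(eq_sym w) ?(negPf uw) ?(negPf vw).
have [x] : exists x, x \notin [set src d; src (rev G d)].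
  have: 0 < #|~: [set src d; src (rev G d)]|.
    rewrite -(ltn_add2l #|[set src d; src (rev G d)]|) cardsC addn0.
    by apply: leq_trans V_gt2; rewrite ltnS cards2; case: (_ != _).
  by case/card_gt0P=> x; rewrite inE; exists x.
rewrite !inE negb_or => /andP[xd xrd] u v.
have toward w : connect (adjacent_without d) w x /\ connect (adjacent_without d) x w.
  have [->|wd] := eqVneq w (src d).
    have dr : src d != src (rev G d) by rewrite eq_sym rev_src.
    by split; apply: (connS (src (rev G d))); rewrite ?set22.
  by split; apply: (connS (src d)); rewrite ?set21.
exact: connect_trans (toward u).1 (toward v).2.
Qed.

Lemma two_faces_at_vertex v : plane G -> two_connected G -> 2 < #|vertex G| ->
  1 < #|[set f in faces G | incident v f]|.
Proof.
move=> plG G2 V_gt2; have [V_gt1 conn _] := G2.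
have [d dv] := connected_dart v V_gt1 conn.
(* The face of [rot G d] is that of [rev G d], the other side of [d], but [rot G d] leaves [v]. *)
apply/card_gt1P; exists (face (rot G d)), (face d).
have face_v e : src e = v -> face e \in [set f in faces G | incident v f].
  move=> ev; rewrite inE face_in_faces; apply/existsP; exists e.
  by rewrite porbit_id ev eqxx.
split; [by apply: face_v; rewrite src_rot | exact: face_v |].
by rewrite -face_rev plane_nonbridge_faces //; apply: two_connected_nonbridge.
Qed.

(** * Double counting and the colouring bound *)

Lemma sum_face_degree :
  \sum_(f in faces G) face_degree f = \sum_v #|[set f in faces G | incident v f]|.
Proof.
transitivity (\sum_(f in faces G) \sum_v incident v f).
  by apply: eq_bigr => f _; rewrite /face_degree cardsE -sum1_card big_mkcond.
rewrite exchange_big; apply: eq_bigr => v _.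
by rewrite cardsE -sum1_card [RHS]big_mkcondr.
Qed.

(** The boundary walk contains both ends of an edge, which differ as there are no loops. *)
Lemma face_degree_gt1 f : f \in faces G -> 1 < face_degree f.
Proof.
case/imsetP=> d _ ->; apply/card_gt1P; exists (src d), (src (face_perm G d)).
split; first by rewrite inE; apply/existsP; exists d; rewrite porbit_id eqxx.
  by rewrite inE; apply/existsP; exists (face_perm G d); rewrite mem_porbit1 eqxx.
by rewrite permM src_rot eq_sym rev_src.
Qed.

Lemma max_face_degree_ge f : f \in faces G -> face_degree f <= max_face_degree G.
Proof. by move=> fF; apply: (leq_bigmax_cond _ fF). Qed.

Lemma cyclic_chromatic_number_le_card : cyclic_chromatic_number G <= #|vertex G|.
Proof.
rewrite /cyclic_chromatic_number; case: ex_minnP => k _; apply.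
apply/existsP; exists [ffun v => enum_rank v].
apply/forall_inP => f _; apply/forallP => u; apply/forallP => v.
by apply/implyP => /and3P[uv _ _]; rewrite !ffunE (inj_eq enum_rank_inj).
Qed.

End EdgeSpace.

Theorem lemma1 (G : embedded_graph) :
  plane G -> two_connected G -> #|faces G| = 3 ->
  cyclic_chromatic_number G <= (3 * max_face_degree G) %/ 2.
Proof.
move=> plG G2 F3; apply: leq_trans (cyclic_chromatic_number_le_card G) _.
(* With at most two vertices an edge may be a bridge; there [#|vertex G| <= 3] and a face degree of
   at least 2 suffice. *)
rewrite leq_divRL //; have [V_le2|V_gt2] := leqP #|vertex G| 2.
  have [f fF] : exists f, f \in faces G by apply/card_gt0P; rewrite F3.
  have max_gt1 := leq_trans (face_degree_gt1 fF) (max_face_degree_ge fF).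
  by apply: leq_mul max_gt1; apply: leq_trans V_le2 _.
apply: (@leq_trans (\sum_(f in faces G) face_degree f)).
  rewrite sum_face_degree -sum_nat_const; apply: leq_sum => v _.
  exact: two_faces_at_vertex.
rewrite -F3 -sum_nat_const; apply: leq_sum => f; exact: max_face_degree_ge.
Qed.
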